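(* Let $\Lambda_{\mathscr{M}}$ be a Brauer configuration algebra induced by a Brauer configuration $\mathscr{M}=(M,\mathscr{M}_1,\mu,\mathcal{O})$ with polygons $\mathscr{M}_1=\{(U_1,f_1),\dots,(U_m,f_m)\}$ such that for every $1\le i\le m$ and every $u_{i,j}\in U_i$ one has $f_i(u_{i,j})=1$ (every vertex occurs at most once in each polygon). Suppose that there are $n$ vertices $\alpha$ such that $val(\alpha)=1$. Then the center $Z(\Lambda_{\mathscr{M}})$ satisfies $$\dim_k Z(\Lambda_{\mathscr{M}})=m+n+1.$$
   Context: $k$ is a field. Brauer configuration. A Brauer configuration $\mathscr{M}=(M,\mathscr{M}_1,\mu,\mathcal{O})$ consists of a finite set $M$ (vertices), a finite (indexed) collection $\mathscr{M}_1$ of finite multisets $(U_i,f_i)$ (polygons), where $U_i\subseteq M$ and $f_i(u)\ge1$ is the multiplicity of $u\in U_i$, with $\sum_{u\in U_i}f_i(u)>1$ and $M=\bigcup_i U_i$, a multiplicity function $\mu$ from $M$ to the positive integers, and an orientation $\mathcal{O}$. The valency $val(v)$ of a vertex $v$ is the sum of $f_i(v)$ over all polygons containing $v$. By standing convention, $\mu(v)=2$ whenever $val(v)=1$. The orientation is given by a successor sequence for each vertex $v$, that is, a linear order on the polygons containing $v$ (with $U_i$ repeated as $f_i(v)$ consecutive distinct copies), made into a circular order by declaring the first term to follow the last one. Brauer quiver. $Q_{\mathscr{M}}$ has one vertex for each polygon, and for each $v\in M$ and each pair of consecutive terms $U<U'$ in the circular order of $v$ (including the step from the last term to the first) one arrow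 $U\to U'$ (a single loop if $val(v)=1$). The cycles $C_v$ in $Q_{\mathscr{M}}$ defined by running once through the circular order of a vertex $v$ are called special cycles. Brauer configuration algebra. $\Lambda_{\mathscr{M}}=kQ_{\mathscr{M}}/I$ where $I$ is generated by: (1) $C_v^{\mu(v)}-C_w^{\mu(w)}$ if $v$ and $w$ are vertices in the same polygon, where $C_v$, $C_w$ are special cycles of $v$ and $w$ at that polygon; (2) $C_v^{\mu(v)}a$ if $a$ is the first arrow of a special cycle $C_v$ associated with a vertex $v$; (3) $ab$ if $a,b$ are arrows of different special cycles and $ab$ is an element of the path algebra $kQ_{\mathscr{M}}$.
   Formalization: Two hypotheses are added, without which the claim fails: the configuration is connected and nonempty (m ≥ 1), and μ(v)=1 for every vertex v with val(v)≠1. E.g. U_1=U_2={1,2} with μ=2 at both vertices gives dimension 5, not 3. *)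

(* Defs.v *)
From HB Require Import structures.
From mathcomp Require Import all_boot all_order all_algebra.
From mathcomp Require Import finmap boolp generic_quotient ring_quotient.
From mathcomp.multinomials Require Import monalg.

Set Implicit Arguments.
Unset Strict Implicit.
Unset Printing Implicit Defensive.

Import GRing.Theory.
Local Open Scope ring_scope.
Local Open Scope quotient_scope.

(** * Path algebras *)

Record quiver := Quiver {
  qvertex : finType;
  qarrow : finType;
  qsrc : qarrow -> qvertex;
  qtgt : qarrow -> qvertex }.

Section Paths.
Variable Q : quiver.

Fixpoint walk (s : qvertex Q) (p : seq (qarrow Q)) : bool :=
  if p is a :: p' then (qsrc a == s) && walk (qtgt a) p' else true.

(** A path is its starting vertex together with its list of arrows, in the
    order in which they are travelled; the starting vertex with no arrow is the
    trivial path. *)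
Definition qpath := {x : qvertex Q * seq (qarrow Q) | walk x.1 x.2}.
HB.instance Definition _ := SubType.on qpath.
HB.instance Definition _ := Choice.on qpath.

Definition pstart (p : qpath) : qvertex Q := (val p).1.
Definition parrows (p : qpath) : seq (qarrow Q) := (val p).2.
Definition pend (p : qpath) : qvertex Q :=
  last (pstart p) [seq qtgt a | a <- parrows p].

Definition trivial_path (s : qvertex Q) : qpath := Sub (s, [::]) isT.

Lemma walk_arrow (a : qarrow Q) : walk (qsrc a) [:: a].
Proof. by rewrite /= eqxx. Qed.

Definition arrow_path (a : qarrow Q) : qpath :=
  Sub (qsrc a, [:: a]) (walk_arrow a).

(** [p] followed by [q], or [None] if [p] does not end where [q] starts. *)
Definition pcomp (p q : qpath) : option qpath :=
  if pend p == pstart q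
  then insub (pstart p, parrows p ++ parrows q) : option qpath else None.

Lemma walk_cat s p q :
  walk s (p ++ q) = walk s p && walk (last s [seq qtgt a | a <- p]) q.
Proof. by elim: p s => //= a p IH s; rewrite IH andbA. Qed.

Lemma pcompP p q r :
  pcomp p q = Some r <->
  [/\ pend p = pstart q, pstart r = pstart p & parrows r = parrows p ++ parrows q].
Proof.
rewrite /pcomp; split.
  case: eqP => // epq; case: insubP => // u _ eu [<-].
  by rewrite /pstart /parrows eu.
case=> -> e1 e2; rewrite eqxx -e1 -e2.
have -> : (pstart r, parrows r) = val r by rewrite -surjective_pairing.
by rewrite valK.
Qed.

Lemma pend_comp p q r : pcomp p q = Some r -> pend r = pend q.
Proof.
case/pcompP=> e s a; rewrite {1}/pend s a map_cat last_cat.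
by rewrite -/(pend p) e.
Qed.

Lemma pcomp_some p q : pend p = pstart q -> exists r, pcomp p q = Some r.
Proof.
move=> e; rewrite /pcomp e eqxx; case: insubP => [u _ _|]; first by exists u.
rewrite /= walk_cat -/(pend p) e.
by rewrite (valP p : walk _ _) (valP q : walk _ _).
Qed.

Lemma qpath_inj (p q : qpath) :
  pstart p = pstart q -> parrows p = parrows q -> p = q.
Proof.
move=> e1 e2; apply: val_inj.
by rewrite [LHS]surjective_pairing [RHS]surjective_pairing; congr pair.
Qed.

Lemma pcomp_trivl s q :
  pcomp (trivial_path s) q = if s == pstart q then Some q else None.
Proof.
case: eqP => [e|ne]; first by apply/pcompP; split.
by rewrite /pcomp; case: eqP.
Qed.

Lemma pcomp_trivr p s :
  pcomp p (trivial_path s) = if pend p == s then Some p else None.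
Proof.
case: eqP => [e|ne]; first by apply/pcompP; split; rewrite ?cats0.
by rewrite /pcomp; case: eqP.
Qed.

Lemma pcompA p q r :
  obind (pcomp p) (pcomp q r) = obind (pcomp^~ r) (pcomp p q).
Proof.
have [epq|npq] := eqVneq (pend p) (pstart q); last first.
  have -> : pcomp p q = None by rewrite /pcomp (negPf npq).
  case eqr: (pcomp q r) => [t|] //=; case/pcompP: eqr => _ st _.
  by rewrite /pcomp st (negPf npq).
have [u eu] := pcomp_some epq; rewrite eu /=.
have [eqr|nqr] := eqVneq (pend q) (pstart r); last first.
  have -> : pcomp q r = None by rewrite /pcomp (negPf nqr).
  by rewrite /= /pcomp (pend_comp eu) (negPf nqr).
have [t et] := pcomp_some eqr; rewrite et /=.
have /pcompP[_ su au] := eu; have /pcompP[_ st at_] := et.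
have [w ew] : exists w, pcomp p t = Some w by apply: pcomp_some; rewrite st.
rewrite ew; apply/esym/pcompP; case/pcompP: ew => _ sw aw.
by split; [rewrite (pend_comp eu) | rewrite sw su | rewrite aw au at_ catA].
Qed.

End Paths.

(** The path algebra: finitely supported functions on paths, a product of paths
    being their concatenation (the left factor is travelled first) or zero. The
    sum of the trivial paths is its unit. *)
Definition pathalg (k : fieldType) (Q : quiver) := {malg k[qpath Q]}.
HB.instance Definition _ k Q := GRing.Zmodule.on (pathalg k Q).

(** Operations are locked because unification would otherwise unfold the
    finitely supported functions. *)
HB.lock Definition pathalg_scale (k : fieldType) (Q : quiver) (c : k)
  (x : pathalg k Q) : pathalg k Q := c *: (x : {malg k[qpath Q]}).

Section PathAlgebraModule.
Variables (k : fieldType) (Q : quiver).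

Lemma pathalg_scaleA a b x :
  pathalg_scale a (pathalg_scale b x) = pathalg_scale (a * b) x :> pathalg k Q.
Proof. by rewrite unlock; exact: scalerA. Qed.

Lemma pathalg_scale1 : left_id 1 (@pathalg_scale k Q).
Proof. by move=> x; rewrite unlock; exact: scale1r. Qed.

Lemma pathalg_scaleDr : right_distributive (@pathalg_scale k Q) +%R.
Proof. by move=> c x y; rewrite unlock; exact: scalerDr. Qed.

Lemma pathalg_scaleDl x : {morph (@pathalg_scale k Q)^~ x : a b / a + b}.
Proof. by move=> a b; rewrite unlock; exact: scalerDl. Qed.

HB.instance Definition _ := GRing.Zmodule_isLmodule.Build k (pathalg k Q)
  pathalg_scaleA pathalg_scale1 pathalg_scaleDr pathalg_scaleDl.

Lemma pathalg_coefZ c (x : pathalg k Q) p : (c *: x)@_p = c * x@_p.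
Proof. by rewrite /GRing.scale /= unlock; exact: mcoeffZ. Qed.

Lemma pathalg_suppZ c (x : pathalg k Q) : (msupp (c *: x) `<=` msupp x)%fset.
Proof. by rewrite /GRing.scale /= unlock; exact: msuppZ_le. Qed.

End PathAlgebraModule.

HB.lock Definition path_elt (k : fieldType) (Q : quiver) (p : qpath Q) :
  pathalg k Q := << p >>.
Arguments path_elt {k Q}.

Definition path_mul (k : fieldType) (Q : quiver) (p q : qpath Q) : pathalg k Q :=
  if pcomp p q is Some r then path_elt r else 0.
Arguments path_mul {k Q}.

HB.lock Definition pathalg_one (k : fieldType) (Q : quiver) : pathalg k Q :=
  \sum_s path_elt (trivial_path s).

HB.lock Definition pathalg_mul (k : fieldType) (Q : quiver) (x y : pathalg k Q) :
  pathalg k Q :=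
  \sum_(p <- msupp x) \sum_(q <- msupp y) (x@_p * y@_q) *: path_mul p q.
Arguments pathalg_mul {k Q}.

Section PathAlgebra.
Variables (k : fieldType) (Q : quiver).
Implicit Types (p q r : qpath Q) (x y z : pathalg k Q).

Lemma pathalg_mulw (d1 d2 : {fset qpath Q}) x y :
  (msupp x `<=` d1)%fset -> (msupp y `<=` d2)%fset ->
  pathalg_mul x y = \sum_(p <- d1) \sum_(q <- d2) (x@_p * y@_q) *: path_mul p q.
Proof.
move=> le1 le2; rewrite unlock (big_fset_incl _ le1) /=.
  apply: eq_bigr => p _; apply: big_fset_incl => // q _ /mcoeff_outdom ->.
  by rewrite mulr0 scale0r.
move=> p _ /mcoeff_outdom xp; rewrite big1 // => q _.
by rewrite xp mul0r scale0r.
Qed.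

Lemma pathalg_mulDl : left_distributive (@pathalg_mul k Q) +%R.
Proof.
move=> x y z; pose d := (msupp x `|` msupp y)%fset.
rewrite (@pathalg_mulw d (msupp z)) ?msuppD_le ?fsubset_refl //.
rewrite (@pathalg_mulw d (msupp z) x) ?fsubsetUl ?fsubset_refl //.
rewrite (@pathalg_mulw d (msupp z) y) ?fsubsetUr ?fsubset_refl //.
rewrite -big_split; apply: eq_bigr => p _; rewrite -big_split.
by apply: eq_bigr => q _; rewrite mcoeffD mulrDl scalerDl.
Qed.

Lemma pathalg_mulDr : right_distributive (@pathalg_mul k Q) +%R.
Proof.
move=> z x y; pose d := (msupp x `|` msupp y)%fset.
rewrite (@pathalg_mulw (msupp z) d) ?msuppD_le ?fsubset_refl //.
rewrite (@pathalg_mulw (msupp z) d z x) ?fsubsetUl ?fsubset_refl //.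
rewrite (@pathalg_mulw (msupp z) d z y) ?fsubsetUr ?fsubset_refl //.
rewrite -big_split; apply: eq_bigr => p _; rewrite -big_split.
by apply: eq_bigr => q _; rewrite mcoeffD mulrDr scalerDl.
Qed.

Lemma pathalg_mul0l : left_zero 0 (@pathalg_mul k Q).
Proof. by move=> x; rewrite unlock msupp0 big_seq_fset0. Qed.

Lemma pathalg_mul0r : right_zero 0 (@pathalg_mul k Q).
Proof.
by move=> x; rewrite unlock msupp0 big1 // => p _; rewrite big_seq_fset0.
Qed.

Lemma pathalg_mulZl c x y : pathalg_mul (c *: x) y = c *: pathalg_mul x y.
Proof.
rewrite (@pathalg_mulw (msupp x) (msupp y)) ?pathalg_suppZ ?fsubset_refl //.
rewrite [in RHS]unlock scaler_sumr; apply: eq_bigr => p _.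
rewrite scaler_sumr; apply: eq_bigr => q _.
by rewrite pathalg_coefZ scalerA mulrA.
Qed.

Lemma pathalg_mulZr c x y : pathalg_mul x (c *: y) = c *: pathalg_mul x y.
Proof.
rewrite (@pathalg_mulw (msupp x) (msupp y)) ?pathalg_suppZ ?fsubset_refl //.
rewrite [in RHS]unlock scaler_sumr; apply: eq_bigr => p _.
rewrite scaler_sumr; apply: eq_bigr => q _.
by rewrite pathalg_coefZ scalerA mulrCA.
Qed.

Lemma pathalg_mul_path p q :
  pathalg_mul (path_elt p) (path_elt q) = path_mul p q :> pathalg k Q.
Proof.
rewrite !path_elt.unlock (@pathalg_mulw [fset p]%fset [fset q]%fset) ?msuppU_le //.
by rewrite !big_seq_fset1 !mcoeffUU mulr1 scale1r.
Qed.

Lemma malgUZ (K : choiceType) (c : k) (p : K) :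
  << c *g p >> = c *: << p >> :> {malg k[K]}.
Proof. by apply/malgP => q; rewrite mcoeffZ !mcoeffU mulr_natr. Qed.

Lemma pathalgE x : x = \sum_(p <- msupp x) x@_p *: path_elt p.
Proof.
apply: etrans (monalgE x) _; apply: eq_bigr => p _.
by rewrite /GRing.scale /= pathalg_scale.unlock path_elt.unlock; exact: malgUZ.
Qed.

Lemma pathalg_mul_suml I (s : seq I) (F : I -> pathalg k Q) y :
  pathalg_mul (\sum_(i <- s) F i) y = \sum_(i <- s) pathalg_mul (F i) y.
Proof.
exact: (big_morph (pathalg_mul^~ y)
  (fun a b => pathalg_mulDl a b y) (pathalg_mul0l y)).
Qed.

Lemma pathalg_mul_sumr I (s : seq I) (F : I -> pathalg k Q) y :
  pathalg_mul y (\sum_(i <- s) F i) = \sum_(i <- s) pathalg_mul y (F i).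
Proof.
exact: (big_morph (pathalg_mul y)
  (fun a b => pathalg_mulDr y a b) (pathalg_mul0r y)).
Qed.

Lemma path_mulA p q r :
  pathalg_mul (path_elt p) (path_mul q r) =
  pathalg_mul (path_mul p q) (path_elt r) :> pathalg k Q.
Proof.
have := pcompA p q r; rewrite {1 2}/path_mul.
case: (pcomp q r) => [t|]; case: (pcomp p q) => [u|] /=.
- by move=> e; rewrite !pathalg_mul_path /path_mul e.
- by move=> e; rewrite pathalg_mul_path /path_mul e (pathalg_mul0l (path_elt r)).
- by move=> e; rewrite pathalg_mul_path /path_mul -e (pathalg_mul0r (path_elt p)).
- by move=> _; rewrite (pathalg_mul0l (path_elt r)) (pathalg_mul0r (path_elt p)).
Qed.

Lemma pathalg_ind (P : pathalg k Q -> Prop) :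
  P 0 -> (forall x y, P x -> P y -> P (x + y)) ->
  (forall c p, P (c *: path_elt p)) -> forall x, P x.
Proof.
move=> P0 PD PZ x; rewrite (pathalgE x).
by elim/big_ind: _ => // p _; exact: PZ.
Qed.

Lemma pathalg_mulA : associative (@pathalg_mul k Q).
Proof.
move=> x y z; elim/pathalg_ind: x => [|x x' ex ex'|a p].
- by rewrite !pathalg_mul0l.
- by rewrite !pathalg_mulDl ex ex'.
elim/pathalg_ind: y => [|y y' ey ey'|b q].
- by rewrite pathalg_mul0l pathalg_mul0r pathalg_mul0l.
- by rewrite pathalg_mulDl !pathalg_mulDr pathalg_mulDl ey ey'.
elim/pathalg_ind: z => [|z z' ez ez'|c r].
- by rewrite !pathalg_mul0r.
- by rewrite !pathalg_mulDr ez ez'.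
rewrite !pathalg_mulZl.
rewrite !(pathalg_mulZr b) pathalg_mulZl !pathalg_mulZr.
by rewrite !pathalg_mul_path path_mulA.
Qed.

Lemma pathalg_mul1l : left_id (pathalg_one k Q) (@pathalg_mul k Q).
Proof.
move=> x; rewrite pathalg_one.unlock; rewrite [in LHS](pathalgE x) [in RHS](pathalgE x).
rewrite pathalg_mul_sumr; apply: eq_bigr => q _; rewrite pathalg_mulZr.
congr (_ *: _); rewrite pathalg_mul_suml (bigD1_seq (pstart q))
  ?index_enum_uniq ?mem_index_enum //=.
rewrite pathalg_mul_path /path_mul pcomp_trivl eqxx big1 ?addr0 // => s ns.
by rewrite pathalg_mul_path /path_mul pcomp_trivl (negPf ns).
Qed.

Lemma pathalg_mul1r : right_id (pathalg_one k Q) (@pathalg_mul k Q).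
Proof.
move=> x; rewrite pathalg_one.unlock; rewrite [in LHS](pathalgE x) [in RHS](pathalgE x).
rewrite pathalg_mul_suml; apply: eq_bigr => q _; rewrite pathalg_mulZl.
congr (_ *: _); rewrite pathalg_mul_sumr (bigD1_seq (pend q))
  ?index_enum_uniq ?mem_index_enum //=.
rewrite pathalg_mul_path /path_mul pcomp_trivr eqxx big1 ?addr0 // => s ns.
by rewrite pathalg_mul_path /path_mul pcomp_trivr eq_sym (negPf ns).
Qed.

(** Only a [pzRingType]: the quiver may be empty. *)
HB.instance Definition _ := GRing.Zmodule_isPzRing.Build (pathalg k Q)
  pathalg_mulA pathalg_mul1l pathalg_mul1r pathalg_mulDl pathalg_mulDr.

Lemma pathalg_scaleAl (c : k) x y : c *: (x * y) = (c *: x) * y.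
Proof. exact/esym/pathalg_mulZl. Qed.

Lemma pathalg_scaleAr (c : k) x y : c *: (x * y) = x * (c *: y).
Proof. exact/esym/pathalg_mulZr. Qed.

Definition arrow_elt (a : qarrow Q) : pathalg k Q := path_elt (arrow_path a).

End PathAlgebra.

(** * Quotients of path algebras *)

Inductive ideal_gen (A : pzRingType) (S : A -> Prop) : A -> Prop :=
| Ideal_gen x : S x -> ideal_gen S x
| Ideal_0 : ideal_gen S 0
| Ideal_add x y : ideal_gen S x -> ideal_gen S y -> ideal_gen S (x + y)
| Ideal_mull a x : ideal_gen S x -> ideal_gen S (a * x)
| Ideal_mulr a x : ideal_gen S x -> ideal_gen S (x * a).

Section QuotientAlgebra.
Variables (k : fieldType) (Q : quiver) (rel : pathalg k Q -> Prop).
Implicit Types x y : pathalg k Q.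

Definition rel_ideal : pathalg k Q -> bool := fun x => `[< ideal_gen rel x >].

Lemma rel_ideal_zmod_closed : zmod_closed rel_ideal.
Proof.
split; first by apply/asboolP; exact: Ideal_0.
move=> x y /asboolP Ix /asboolP Iy; apply/asboolP; apply: Ideal_add => //.
by rewrite -mulN1r; exact: Ideal_mull.
Qed.
HB.instance Definition _ :=
  GRing.isZmodClosed.Build (pathalg k Q) rel_ideal rel_ideal_zmod_closed.

Lemma rel_idealMl a x : x \in rel_ideal -> a * x \in rel_ideal.
Proof. by move=> /asboolP Ix; apply/asboolP; exact: Ideal_mull. Qed.

Lemma rel_idealMr a x : x \in rel_ideal -> x * a \in rel_ideal.
Proof. by move=> /asboolP Ix; apply/asboolP; exact: Ideal_mulr. Qed.

(** [kQ / I] with [I] the two-sided ideal generated by [rel]. *)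
Definition quiver_alg := Quotient.quot (GRing.ZmodClosed.clone _ rel_ideal _).
HB.instance Definition _ := GRing.Zmodule.on quiver_alg.

Definition quiver_pi (x : pathalg k Q) : quiver_alg := \pi_(quiver_alg) x.

Lemma quiver_piP x y : quiver_pi x = quiver_pi y <-> ideal_gen rel (x - y).
Proof.
rewrite /quiver_pi; split.
  by move=> /eqP; rewrite -Quotient.idealrBE => /asboolP.
by move=> I; apply/eqP; rewrite -Quotient.idealrBE; apply/asboolP.
Qed.

Lemma quiver_pi_surj (u : quiver_alg) : exists x, u = quiver_pi x.
Proof. by exists (repr u); rewrite /quiver_pi reprK. Qed.

Lemma quiver_piD : {morph quiver_pi : x y / x + y}.
Proof. by move=> x y; rewrite /quiver_pi !piE. Qed.

Definition quiver_alg_one : quiver_alg := quiver_pi 1.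
Definition quiver_alg_mul (u v : quiver_alg) : quiver_alg :=
  quiver_pi (repr u * repr v).
Definition quiver_alg_scale (c : k) (u : quiver_alg) : quiver_alg :=
  quiver_pi (c *: repr u).

Lemma quiver_pi_mul x y :
  quiver_alg_mul (quiver_pi x) (quiver_pi y) = quiver_pi (x * y).
Proof.
rewrite /quiver_alg_mul; set x' := repr _; set y' := repr _.
have Ix : ideal_gen rel (x' - x) by apply/quiver_piP; rewrite /quiver_pi reprK.
have Iy : ideal_gen rel (y' - y) by apply/quiver_piP; rewrite /quiver_pi reprK.
apply/quiver_piP.
have -> : x' * y' - x * y = (x' - x) * y' + x * (y' - y).
  by rewrite mulrBl mulrBr addrA subrK.
by apply: Ideal_add; [exact: Ideal_mulr | exact: Ideal_mull].
Qed.

Lemma quiver_pi_scale c x :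
  quiver_alg_scale c (quiver_pi x) = quiver_pi (c *: x).
Proof.
rewrite /quiver_alg_scale; apply/quiver_piP.
rewrite -scalerBr -[_ - _]mul1r pathalg_scaleAl; apply: Ideal_mull.
by apply/quiver_piP; rewrite /quiver_pi reprK.
Qed.

Lemma quiver_alg_mulA : associative quiver_alg_mul.
Proof.
move=> u v w; have [x ->] := quiver_pi_surj u; have [y ->] := quiver_pi_surj v.
by have [z ->] := quiver_pi_surj w; rewrite !quiver_pi_mul mulrA.
Qed.

Lemma quiver_alg_mul1l : left_id quiver_alg_one quiver_alg_mul.
Proof.
by move=> u; have [x ->] := quiver_pi_surj u; rewrite quiver_pi_mul mul1r.
Qed.

Lemma quiver_alg_mul1r : right_id quiver_alg_one quiver_alg_mul.
Proof.
by move=> u; have [x ->] := quiver_pi_surj u; rewrite quiver_pi_mul mulr1.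
Qed.

Lemma quiver_alg_mulDl : left_distributive quiver_alg_mul +%R.
Proof.
move=> u v w; have [x ->] := quiver_pi_surj u; have [y ->] := quiver_pi_surj v.
have [z ->] := quiver_pi_surj w.
by rewrite !quiver_pi_mul -!quiver_piD quiver_pi_mul mulrDl.
Qed.

Lemma quiver_alg_mulDr : right_distributive quiver_alg_mul +%R.
Proof.
move=> u v w; have [x ->] := quiver_pi_surj u; have [y ->] := quiver_pi_surj v.
have [z ->] := quiver_pi_surj w.
by rewrite !quiver_pi_mul -!quiver_piD quiver_pi_mul mulrDr.
Qed.

HB.instance Definition _ := GRing.Zmodule_isPzRing.Build quiver_alg
  quiver_alg_mulA quiver_alg_mul1l quiver_alg_mul1r
  quiver_alg_mulDl quiver_alg_mulDr.

Lemma quiver_alg_scaleA a b u :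
  quiver_alg_scale a (quiver_alg_scale b u) = quiver_alg_scale (a * b) u.
Proof.
by have [x ->] := quiver_pi_surj u; rewrite !quiver_pi_scale scalerA.
Qed.

Lemma quiver_alg_scale1 : left_id 1 quiver_alg_scale.
Proof.
by move=> u; have [x ->] := quiver_pi_surj u; rewrite quiver_pi_scale scale1r.
Qed.

Lemma quiver_alg_scaleDr : right_distributive quiver_alg_scale +%R.
Proof.
move=> a u v; have [x ->] := quiver_pi_surj u; have [y ->] := quiver_pi_surj v.
by rewrite -quiver_piD !quiver_pi_scale scalerDr quiver_piD.
Qed.

Lemma quiver_alg_scaleDl u :
  {morph (fun c => quiver_alg_scale c u) : a b / a + b}.
Proof.
move=> a b; have [x ->] := quiver_pi_surj u.
by rewrite !quiver_pi_scale scalerDl quiver_piD.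
Qed.

HB.instance Definition _ := GRing.Zmodule_isLmodule.Build k quiver_alg
  quiver_alg_scaleA quiver_alg_scale1 quiver_alg_scaleDr quiver_alg_scaleDl.

Lemma quiver_piM : {morph quiver_pi : x y / x * y}.
Proof. by move=> x y; exact/esym/quiver_pi_mul. Qed.

Lemma quiver_piZ c : {morph quiver_pi : x / c *: x}.
Proof. by move=> x; exact/esym/quiver_pi_scale. Qed.

Lemma quiver_alg_scaleAl (c : k) (u v : quiver_alg) :
  c *: (u * v) = (c *: u) * v.
Proof.
have [x ->] := quiver_pi_surj u; have [y ->] := quiver_pi_surj v.
by rewrite -quiver_piM -!quiver_piZ -quiver_piM pathalg_scaleAl.
Qed.

Lemma quiver_alg_scaleAr (c : k) (u v : quiver_alg) :
  c *: (u * v) = u * (c *: v).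
Proof.
have [x ->] := quiver_pi_surj u; have [y ->] := quiver_pi_surj v.
by rewrite -quiver_piM -!quiver_piZ -quiver_piM pathalg_scaleAr.
Qed.

End QuotientAlgebra.

Definition center (A : pzRingType) : A -> Prop :=
  fun z => forall x : A, z * x = x * z.

(** [P] is a linear subspace of dimension [d]: it is exactly the span of some
    linearly independent family of [d] vectors. *)
Definition has_dim (k : fieldType) (V : lmodType k) (P : V -> Prop) (d : nat) :=
  exists b : 'I_d -> V,
    (forall c : 'I_d -> k, \sum_i c i *: b i = 0 -> forall i, c i = 0) /\
    (forall x, P x <-> exists c : 'I_d -> k, x = \sum_i c i *: b i).

(** * Brauer configurations *)

(** [occ i v] is the multiplicity [f_i(v)], extended by [0] outside of [U_i], so
    that [U_i] is the support of [occ i]. [order v] lists once each polygon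
    containing [v]; it becomes the successor sequence of [v] by repeating every
    polygon according to its multiplicity. *)
Record brauer_config (M : finType) (m : nat) := BrauerConfig {
  occ : 'I_m -> M -> nat;
  mu : M -> nat;
  order : M -> seq 'I_m;
  occ_sum_gt1 : forall i, (1 < \sum_v occ i v)%N;
  occ_cover : forall v, exists i, (0 < occ i v)%N;
  mu_gt0 : forall v, (0 < mu v)%N;
  mu_val1 : forall v, (\sum_i occ i v = 1)%N -> mu v = 2%N;
  order_uniq : forall v, uniq (order v);
  mem_order : forall v i, (i \in order v) = (0 < occ i v)%N }.

Section BrauerConfiguration.
Variables (M : finType) (m : nat) (B : brauer_config M m).

Definition polygon (i : 'I_m) : {set M} := [set v | (0 < occ B i v)%N].

Definition valency (v : M) : nat := (\sum_i occ B i v)%N.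

Definition succ_seq (v : M) : seq 'I_m :=
  flatten [seq nseq (occ B i v) i | i <- order B v].

Lemma size_succ_seq v : size (succ_seq v) = valency v.
Proof.
rewrite /succ_seq size_flatten /shape -map_comp sumnE big_map /valency.
under eq_bigr do rewrite /= size_nseq.
rewrite [RHS](bigID [in order B v]) /= [X in (_ + X)%N]big1 ?addn0; last first.
  by move=> i; rewrite mem_order lt0n negbK => /eqP.
by rewrite big_uniq ?order_uniq.
Qed.

Definition adjacent (i j : 'I_m) : bool :=
  [exists v, (v \in polygon i) && (v \in polygon j)].

Definition connected_config : bool :=
  (0 < m)%N && [forall i, forall j, connect adjacent i j].

(** The arrow [(v, p)] goes from the [p]-th term of the successor sequence of
    [v] to the cyclically next one. *)
Definition barrow := {v : M & 'I_(size (succ_seq v))}.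

Definition brauer_quiver : quiver :=
  @Quiver 'I_m barrow
    (fun a => tnth (in_tuple (succ_seq (tag a))) (tagged a))
    (fun a => tnth (in_tuple (succ_seq (tag a))) (ordS (tagged a))).

Definition next_arrow (a : barrow) : barrow :=
  Tagged (fun v => 'I_(size (succ_seq v))) (ordS (tagged a)).

Variable k : fieldType.
Local Notation kQ := (pathalg k brauer_quiver).

(** The special cycle of the vertex [tag a] whose first arrow is [a]. *)
Definition special_cycle (a : barrow) : kQ :=
  \prod_(j < valency (tag a)) arrow_elt k (iter j next_arrow a : qarrow brauer_quiver).

(** The vertices of a polygon, with their occurrences in it, are given by the
    arrows leaving this polygon: this indexes the special cycles at it. *)
Inductive brauer_rel : kQ -> Prop :=
| Brauer_rel1 (a b : qarrow brauer_quiver) : qsrc a = qsrc b ->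
    brauer_rel (special_cycle a ^+ mu B (tag a) - special_cycle b ^+ mu B (tag b))
| Brauer_rel2 (a : qarrow brauer_quiver) :
    brauer_rel (special_cycle a ^+ mu B (tag a) * arrow_elt k a)
| Brauer_rel3 (a b : qarrow brauer_quiver) : tag a != tag b -> qtgt a = qsrc b ->
    brauer_rel (arrow_elt k a * arrow_elt k b).

Definition brauer_alg := quiver_alg brauer_rel.
HB.instance Definition _ := GRing.PzRing.on brauer_alg.
HB.instance Definition _ := GRing.Lmodule.on brauer_alg.

End BrauerConfiguration.

(* Main.v *)
(** Write [e_i] for the trivial path at the polygon [i] and [S_i] for the common
    value of the [C_v ^ mu v] at [i]. A product of arrows is zero unless it
    follows a special cycle, and then it is zero as soon as it is longer than
    [C_v ^ mu v]. Since a special cycle visits each polygon at most once, the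
    closed paths that survive are the [e_i], the [S_i] and the loops of the
    vertices of valency one; a central [z] equals [\sum_i e_i z e_i], hence is a
    combination of these. The [S_i] and the loops are central, whereas commuting
    with the arrows forces the coefficients of the [e_i] to be all equal. The
    elements [1], [S_i] and the loops are separated by linear forms on [kQ] that
    vanish on the ideal: the coefficients of the paths of length at most one,
    and the sum of the coefficients of all the [C_v ^ mu v] at [i]. *)

From HB Require Import structures.
From mathcomp Require Import all_boot all_algebra.
From mathcomp Require Import finmap.
From mathcomp.multinomials Require Import monalg.
Require Import Defs.

Set Implicit Arguments.
Unset Strict Implicit.
Unset Printing Implicit Defensive.

Import GRing.Theory.
Local Open Scope ring_scope.

(** * Linear forms on path algebras and ideal membership *)

Section PathAlgebra.
Variables (k : fieldType) (Q : quiver).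
Implicit Types (p q r : qpath Q) (x y : pathalg k Q) (f : qpath Q -> k).

(** The linear extension of [f] from the basis of paths. *)
Definition pathalg_eval f x : k := \sum_(p <- msupp x) x@_p * f p.

Lemma pathalg_evalw (d : {fset qpath Q}) f x : (msupp x `<=` d)%fset ->
  pathalg_eval f x = \sum_(p <- d) x@_p * f p.
Proof.
move=> le; apply: big_fset_incl => // p _ /mcoeff_outdom ->.
by rewrite mul0r.
Qed.

Lemma pathalg_eval_is_linear f : linear_for *%R (pathalg_eval f).
Proof.
move=> c x y; pose d := (msupp (c *: x) `|` msupp x `|` msupp y)%fset.
have sx : (msupp x `<=` d)%fset by rewrite /d fsetUAC fsubsetUr.
have sy : (msupp y `<=` d)%fset by rewrite /d fsubsetUr.
rewrite (@pathalg_evalw d); last first.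
  apply: fsubset_trans (msuppD_le _ _) _.
  by rewrite fsubUset sy andbT /d -fsetUA fsubsetUl.
rewrite (pathalg_evalw f sx) (pathalg_evalw f sy) mulr_sumr -big_split.
by apply: eq_bigr => p _; rewrite mcoeffD pathalg_coefZ mulrDl mulrA.
Qed.
HB.instance Definition _ f := GRing.isLinear.Build k (pathalg k Q) k _
  (pathalg_eval f) (pathalg_eval_is_linear f).

Lemma pathalg_eval_path f p : pathalg_eval f (path_elt p) = f p.
Proof.
rewrite path_elt.unlock (@pathalg_evalw [fset p]%fset) ?msuppU_le //.
by rewrite big_seq_fset1 mcoeffUU mul1r.
Qed.

Lemma path_eltM p q : path_elt p * path_elt q = path_mul p q :> pathalg k Q.
Proof. exact: pathalg_mul_path. Qed.

Lemma pathalg_eval_path_mul f p q : (forall r, pstart r = pstart p ->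
  parrows r = parrows p ++ parrows q -> f r = 0) ->
  pathalg_eval f (path_elt p * path_elt q) = 0.
Proof.
move=> f0; rewrite path_eltM /path_mul; case e: (pcomp p q) => [r|];
  last by rewrite raddf0.
by case/pcompP: e => _ e1 e2; rewrite pathalg_eval_path f0.
Qed.

(** The list must be nonempty: an empty product is [1], the sum of all trivial paths, and not a
    single one. *)
Lemma path_elt_prod p a l : parrows p = a :: l ->
  path_elt p = \prod_(b <- a :: l) arrow_elt k b.
Proof.
elim: l a p => [|b l IH] a p ap; have := valP p : walk (pstart p) (parrows p).
  rewrite ap /= => /andP[/eqP sp _].
  by rewrite big_seq1; congr path_elt; apply: qpath_inj.
rewrite ap => /andP[/eqP sp wl].
have wb : walk (qsrc b) (b :: l) by case/andP: wl => _ wl; rewrite /= eqxx.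
have eb : qsrc b = qtgt a by case/andP: wl => /eqP.
rewrite big_cons -(IH b (Sub (qsrc b, b :: l) wb)) // /arrow_elt path_eltM.
rewrite /path_mul.
have -> // : pcomp (arrow_path a) (Sub (qsrc b, b :: l) wb) = Some p.
by apply/pcompP; split; rewrite ?ap //= -[LHS]/(qtgt a) -eb.
Qed.

Lemma trivial_pathM i p : path_elt (trivial_path i) * path_elt p =
  if i == pstart p then path_elt p else 0 :> pathalg k Q.
Proof. by rewrite path_eltM /path_mul pcomp_trivl; case: eqP. Qed.

Lemma mul_trivial_path i p : path_elt p * path_elt (trivial_path i) =
  if pend p == i then path_elt p else 0 :> pathalg k Q.
Proof. by rewrite path_eltM /path_mul pcomp_trivr; case: eqP. Qed.

Lemma pathalg1E : 1 = \sum_i path_elt (trivial_path i) :> pathalg k Q.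
Proof. by rewrite -[LHS]/(pathalg_one k Q) pathalg_one.unlock. Qed.

(** Trivial paths and arrows generate [kQ] as an algebra; this reduces centrality to commuting with
    them. *)
Lemma pathalg_gen (P : pathalg k Q -> Prop) :
  P 0 -> (forall x y, P x -> P y -> P (x + y)) ->
  (forall c x, P x -> P (c *: x)) -> (forall x y, P x -> P y -> P (x * y)) ->
  (forall i, P (path_elt (trivial_path i))) -> (forall a, P (arrow_elt k a)) ->
  forall x, P x.
Proof.
move=> P0 PD PZ PM Pt Pa; elim/pathalg_ind => // c p; apply: PZ.
case e: (parrows p) => [|a l].
  have -> // : p = trivial_path (pstart p) by apply: qpath_inj.
rewrite (path_elt_prod e) {e}; elim: l a => [|b l IH] a; rewrite big_cons.
  by rewrite big_nil mulr1.
by apply: PM.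
Qed.

Variable rel : pathalg k Q -> Prop.

(** The products of a relation with a path on either side span the ideal. *)
Lemma pathalg_eval_ideal f :
  (forall x, rel x -> forall p q,
     pathalg_eval f (path_elt p * x * path_elt q) = 0) ->
  forall x, ideal_gen rel x -> pathalg_eval f x = 0.
Proof.
move=> f0 x Ix.
(* Unlike the vanishing of [f] itself, this is stable under ideal generation. *)
suff H a b : pathalg_eval f (a * x * b) = 0 by rewrite -(H 1 1) mul1r mulr1.
elim: Ix a b => {x} [r Rr|a b|x y _ IHx _ IHy a b|c x _ IH a b|c x _ IH a b].
- elim/pathalg_ind => [b|x y Hx Hy b|c p].
  + by rewrite !mul0r raddf0.
  + by rewrite !mulrDl raddfD /= Hx Hy addr0.
  elim/pathalg_ind => [|x y Hx Hy|d q].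
  + by rewrite mulr0 raddf0.
  + by rewrite mulrDr raddfD /= Hx Hy addr0.
  by rewrite -!pathalg_scaleAl -!pathalg_scaleAr !linearZ /= f0 // !mulr0.
- by rewrite mulr0 mul0r raddf0.
- by rewrite mulrDr mulrDl raddfD /= IHx IHy addr0.
- by rewrite mulrA IH.
- by rewrite mulrA -mulrA IH.
Qed.

End PathAlgebra.

(** * The projection onto the quotient as an algebra morphism *)

Section QuotientMorphism.
Variables (k : fieldType) (Q : quiver) (rel : pathalg k Q -> Prop).

Lemma quiver_pi_is_linear : linear (quiver_pi rel).
Proof. by move=> c x y; rewrite quiver_piD quiver_piZ. Qed.
HB.instance Definition _ := GRing.isLinear.Build k (pathalg k Q)
  (quiver_alg rel) _ (quiver_pi rel) quiver_pi_is_linear.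

Lemma quiver_pi_is_monoid_morphism : monoid_morphism (quiver_pi rel).
Proof. by split=> // x y; rewrite quiver_piM. Qed.
HB.instance Definition _ := GRing.isMonoidMorphism.Build (pathalg k Q)
  (quiver_alg rel) (quiver_pi rel) quiver_pi_is_monoid_morphism.

Lemma quiver_pi_eq0 x : ideal_gen rel x <-> quiver_pi rel x = 0.
Proof. by rewrite -(raddf0 (quiver_pi rel)) quiver_piP subr0. Qed.

End QuotientMorphism.

(** * Special cycles as orbits of the successor map on arrows *)

Lemma iter_ordS n (p : 'I_n) j : val (iter j (@ordS n) p) = ((p + j) %% n)%N.
Proof.
elim: j => [|j IH] /=; first by rewrite addn0 modn_small.
by rewrite IH -addn1 modnDml addn1 addnS.
Qed.

Lemma prod_traject (R : pzRingType) (T : Type) (f : T -> T) (F : T -> R) x n :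
  \prod_(y <- traject f x n) F y = \prod_(j < n) F (iter j f x).
Proof.
elim: n => [|n IH]; first by rewrite big_nil big_ord0.
by rewrite trajectSr -cats1 big_cat big_seq1 big_ord_recr IH.
Qed.

Section BrauerQuiver.
Variables (M : finType) (m : nat) (B : brauer_config M m) (k : fieldType).
Local Notation Q := (brauer_quiver B).
Local Notation next := (@next_arrow M m B).
Implicit Types (a b : barrow B) (i : 'I_m) (v : M).

(** The length of [C_v ^ mu v]. *)
Definition period v := (valency B v * mu B v)%N.

Lemma tag_iter_next j a : tag (iter j next a) = tag a.
Proof. by elim: j => //= j <-. Qed.

Lemma iter_next_Tagged v (p : 'I_(size (succ_seq B v))) j :
  iter j next (Tagged _ p) = Tagged _ (iter j (@ordS _) p).
Proof. by elim: j => //= j ->. Qed.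

Lemma iter_next_id j a : (iter j next a == a) = (valency B (tag a) %| j)%N.
Proof.
case: a => v p; rewrite iter_next_Tagged eq_Tagged /= -val_eqE iter_ordS.
rewrite -size_succ_seq -[X in _ == X](modn_small (ltn_ord p)).
by rewrite -[X in _ == X %[mod _]]addn0 eqn_modDl mod0n.
Qed.

Lemma special_cycleX a e : special_cycle k a ^+ e =
  \prod_(b <- traject next a (valency B (tag a) * e))
     arrow_elt k (b : qarrow Q).
Proof.
elim: e => [|e IH]; first by rewrite muln0 big_nil.
rewrite exprS IH mulnS trajectD big_cat /= [in LHS]/special_cycle.
have /eqP -> : iter (valency B (tag a)) next a == a by rewrite iter_next_id.
by rewrite -prod_traject.
Qed.

Lemma walk_traject a n : walk (qsrc (a : qarrow Q)) (traject next a n).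
Proof. by elim: n a => //= n IH a; rewrite eqxx; apply: IH. Qed.

Definition traject_path a n : qpath Q :=
  Sub (qsrc (a : qarrow Q), traject next a n) (walk_traject a n).

Lemma traject_pathE a n : (0 < n)%N ->
  path_elt (traject_path a n) =
  \prod_(b <- traject next a n) arrow_elt k (b : qarrow Q).
Proof.
by case: n => // n _; apply: (@path_elt_prod _ _ (traject_path a n.+1) a).
Qed.

Definition cycle_path a : qpath Q := traject_path a (period (tag a)).

Lemma parrows_cycle_path a :
  parrows (cycle_path a) = traject next a (period (tag a)).
Proof. by []. Qed.

Lemma valency_gt0 v : (0 < valency B v)%N.
Proof.
have [i iv] := occ_cover B v.
by rewrite /valency (bigD1 i) //= addn_gt0 iv.
Qed.

(** The convention [mu v = 2] at valency one enters here; it keeps every relation in length at least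
    two, so that the loops survive. *)
Lemma period_gt1 v : (1 < period v)%N.
Proof.
rewrite /period; have := valency_gt0 v; have := mu_gt0 B v.
have := @mu_val1 _ _ B v; rewrite -/(valency B v).
case: valency => [|[|n]] // e; first by rewrite e.
by case: mu => // c _ _; rewrite mulnS.
Qed.

Lemma period_gt0 v : (0 < period v)%N.
Proof. exact: ltnW (period_gt1 v). Qed.

Lemma iter_next_period a : iter (period (tag a)) next a = a.
Proof. by apply/eqP; rewrite iter_next_id dvdn_mulr. Qed.

Lemma special_cycle_mu a :
  special_cycle k a ^+ mu B (tag a) = path_elt (cycle_path a).
Proof. by rewrite special_cycleX traject_pathE ?period_gt0. Qed.

Hypothesis occ1 : forall i u, u \in polygon B i -> occ B i u = 1%N.

Lemma succ_seqE v : succ_seq B v = order B v.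
Proof.
rewrite /succ_seq; have : {subset order B v <= order B v} by [].
elim: {1 3 4}(order B v) => //= i s IH si.
have iv : i \in order B v by rewrite si ?mem_head.
rewrite occ1 ?inE -?mem_order //= IH // => j js.
by rewrite si ?inE ?js ?orbT.
Qed.

Lemma mem_succ_seq v i : (i \in succ_seq B v) = (v \in polygon B i).
Proof. by rewrite succ_seqE mem_order inE. Qed.

(** With multiplicities one the successor sequence has no repetition, so it meets each polygon at
    most once. *)
Lemma arrow_inj a b :
  tag a = tag b -> qsrc (a : qarrow Q) = qsrc (b : qarrow Q) -> a = b.
Proof.
(* A default value for [nth]. *)
have d : 'I_m := qsrc (a : qarrow Q).
case: a b => v p [w q] /= e; subst w; rewrite !(tnth_nth d) /=.
move/eqP; rewrite nth_uniq ?ltn_ord ?succ_seqE ?order_uniq -?succ_seqE ?ltn_ord //.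
by move/eqP/val_inj ->.
Qed.

Lemma next_arrow_unique a b :
  tag a = tag b -> qtgt (a : qarrow Q) = qsrc (b : qarrow Q) -> b = next a.
Proof. by move=> e1 e2; apply: arrow_inj => //; rewrite -e1. Qed.

Lemma arrow_at v i : v \in polygon B i ->
  exists2 a, tag a = v & qsrc (a : qarrow Q) = i.
Proof.
rewrite -mem_succ_seq => /[dup] iv; rewrite -index_mem => lt_i.
exists (Tagged (fun v => 'I_(size (succ_seq B v))) (Ordinal lt_i)) => //=.
by rewrite (tnth_nth i) /= nth_index.
Qed.

(** The multiplicities in a polygon sum to more than one while each is at most one, so every polygon
    has two distinct vertices. *)
Lemma polygon_other i v : exists2 w, w != v & w \in polygon B i.
Proof.
have [/existsP[w /andP[]]|no] :=
    boolP [exists w, (w != v) && (w \in polygon B i)].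
  by exists w.
have := occ_sum_gt1 B i; rewrite (bigD1 v) //= big1 ?addn0.
  have [vi|] := boolP (v \in polygon B i); first by rewrite occ1.
  by rewrite inE -eqn0Ngt => /eqP ->.
move=> w nw; apply/eqP; move: no; rewrite negb_exists => /forallP/(_ w).
by rewrite nw inE -eqn0Ngt.
Qed.

Lemma arrow_other i v : exists2 a, tag a != v & qsrc (a : qarrow Q) = i.
Proof.
by have [w nw /arrow_at[a ta sa]] := polygon_other i v; exists a; rewrite ?ta.
Qed.

End BrauerQuiver.

(** Allows the basis to be indexed by a sum type instead of an ordinal. *)
Lemma has_dim_finType (k : fieldType) (V : lmodType k) (P : V -> Prop)
    (J : finType) (b : J -> V) :
  (forall c : J -> k, \sum_j c j *: b j = 0 -> forall j, c j = 0) ->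
  (forall x, P x <-> exists c : J -> k, x = \sum_j c j *: b j) ->
  has_dim P #|J|.
Proof.
have sumE (c : 'I_#|J| -> k) :
    \sum_i c i *: b (enum_val i) = \sum_j c (enum_rank j) *: b j.
  rewrite (reindex_onto (@enum_rank J) (@enum_val J predT)) /=.
    by apply: eq_big => j; rewrite ?enum_rankK ?eqxx.
  by move=> i _; rewrite enum_valK.
move=> indep span; exists (fun i => b (enum_val i)); split=> [c|x].
  by rewrite sumE => /indep c0 i; rewrite -(enum_valK i) c0.
rewrite span; split=> -[c ->]; last by exists (fun j => c (enum_rank j)).
by exists (fun i => c (enum_val i)); rewrite sumE; apply: eq_bigr => j _;
  rewrite enum_rankK.
Qed.

(** * Products of idempotents, arrows and socle elements *)

Section BrauerAlgebra.
Variables (M : finType) (m : nat) (B : brauer_config M m) (k : fieldType).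
Local Notation Q := (brauer_quiver B).
Local Notation next := (@next_arrow M m B).
Local Notation rel := (@brauer_rel M m B k).
Local Notation L := (quiver_alg rel).
Local Notation pi := (quiver_pi rel).
Local Notation src a := (qsrc (a : qarrow Q)).
Local Notation tgt a := (qtgt (a : qarrow Q)).
Implicit Types (a b c : barrow B) (i : 'I_m) (v : M).

Definition idem i : L := pi (path_elt (trivial_path (i : qvertex Q))).
Definition arrow a : L := pi (arrow_elt k (a : qarrow Q)).
(** The element [S_i] for [i] the source of [a], written with the cycle that starts at [a]. *)
Definition cycle_power a : L := pi (path_elt (cycle_path a)).

Lemma pi_pathE (p : qpath Q) a (l : seq (qarrow Q)) :
  parrows p = a :: l -> pi (path_elt p) = \prod_(b <- a :: l) arrow b.
Proof. by move=> /path_elt_prod->; rewrite rmorph_prod. Qed.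

Lemma cycle_powerE a :
  cycle_power a = \prod_(b <- traject next a (period B (tag a))) arrow b.
Proof. by rewrite /cycle_power traject_pathE ?period_gt0 // rmorph_prod. Qed.

Lemma pend_cycle_path a : pend (cycle_path a) = src a.
Proof.
have pendE n : last (src a) [seq qtgt (b : qarrow Q) | b <- traject next a n]
               = src (iter n next a).
  by case: n => // n; rewrite trajectSr map_rcons last_rcons.
by rewrite /pend [LHS]pendE iter_next_period.
Qed.

Lemma idem_path i (p : qpath Q) :
  idem i * pi (path_elt p) = if i == pstart p then pi (path_elt p) else 0.
Proof.
by rewrite -rmorphM trivial_pathM; case: eqP => // _; rewrite raddf0.
Qed.

Lemma path_idem i (p : qpath Q) :
  pi (path_elt p) * idem i = if pend p == i then pi (path_elt p) else 0.
Proof.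
by rewrite -rmorphM mul_trivial_path; case: eqP => // _; rewrite raddf0.
Qed.

Lemma sum_idem : \sum_i idem i = 1.
Proof. by rewrite -raddf_sum -pathalg1E. Qed.

Lemma idemM i j : idem i * idem j = if i == j then idem i else 0.
Proof. by rewrite idem_path; case: eqP => // ->. Qed.

Lemma idem_arrow i a : idem i * arrow a = if i == src a then arrow a else 0.
Proof. exact: idem_path. Qed.

Lemma arrow_idem i a : arrow a * idem i = if tgt a == i then arrow a else 0.
Proof. exact: path_idem. Qed.

Lemma idem_cycle i a :
  idem i * cycle_power a = if i == src a then cycle_power a else 0.
Proof. exact: idem_path. Qed.

Lemma cycle_idem i a :
  cycle_power a * idem i = if src a == i then cycle_power a else 0.
Proof. by rewrite path_idem pend_cycle_path. Qed.

Lemma cycle_power_src a b : src a = src b -> cycle_power a = cycle_power b.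
Proof.
by move=> e; apply/quiver_piP/Ideal_gen; rewrite -!special_cycle_mu;
  apply: Brauer_rel1.
Qed.

Lemma cycle_arrow_self a : cycle_power a * arrow a = 0.
Proof.
rewrite -rmorphM -special_cycle_mu; apply/quiver_pi_eq0/Ideal_gen.
exact: Brauer_rel2.
Qed.

(** The elements commuting with [z] form a subalgebra. *)
Lemma central_of_gens (z : L) : (forall i, z * idem i = idem i * z) ->
  (forall a, z * arrow a = arrow a * z) -> center z.
Proof.
move=> ze za u; have [x ->] := quiver_pi_surj u.
elim/pathalg_gen: x => //.
- by rewrite raddf0 mulr0 mul0r.
- by move=> x y ex ey; rewrite raddfD mulrDl mulrDr ex ey.
- move=> c x ex; rewrite linearZ /= -quiver_alg_scaleAl -quiver_alg_scaleAr.
  by rewrite ex.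
- by move=> x y ex ey; rewrite rmorphM mulrA ex -mulrA ey mulrA.
Qed.

Hypothesis occ1 : forall i u, u \in polygon B i -> occ B i u = 1%N.

(** Either the arrows do not meet, or [b] belongs to another vertex and relation (3) applies, since
    [next a] is the only arrow of the same vertex leaving the end of [a]. *)
Lemma arrow_mul0 a b : b != next a -> arrow a * arrow b = 0.
Proof.
move=> nb; have [e|ne] := eqVneq (tgt a) (src b).
  rewrite -rmorphM; apply/quiver_pi_eq0/Ideal_gen/Brauer_rel3 => //.
  by apply: contra nb => /eqP /(next_arrow_unique occ1)/(_ e) ->.
have := arrow_idem (tgt a) a; rewrite eqxx => <-.
by rewrite -mulrA idem_arrow (negPf ne) mulr0.
Qed.

(** If [b] leaves the base polygon, relation (1) rewrites the socle element as the cycle starting at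
    [b], and relation (2) applies. *)
Lemma cycle_mul_arrow a b : cycle_power a * arrow b = 0.
Proof.
have [e|ne] := eqVneq (src a) (src b).
  by rewrite (cycle_power_src e) cycle_arrow_self.
have := cycle_idem (src a) a; rewrite eqxx => <-.
by rewrite -mulrA idem_arrow (negPf ne) mulr0.
Qed.

(** At the end of [b] the same socle element is represented by a cycle of
    another vertex, whose first arrow is annihilated by [b]. *)
Lemma arrow_mul_cycle a b : arrow b * cycle_power a = 0.
Proof.
have [e|ne] := eqVneq (tgt b) (src a).
  have [c nc ec] := arrow_other occ1 (src a) (tag b).
  rewrite -(cycle_power_src ec) cycle_powerE.
  case: (period B (tag c)) (period_gt0 B (tag c)) => // n _;
    rewrite big_cons mulrA arrow_mul0 ?mul0r //.
  by apply: contra nc => /eqP ->.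
have := arrow_idem (tgt b) b; rewrite eqxx => <-.
by rewrite -mulrA idem_cycle (negPf ne) mulr0.
Qed.

Lemma cycle_power_central a : center (cycle_power a).
Proof.
apply: central_of_gens => [i|b]; first by rewrite cycle_idem idem_cycle eq_sym.
by rewrite cycle_mul_arrow arrow_mul_cycle.
Qed.

Lemma next_val1 a : valency B (tag a) = 1%N -> next a = a.
Proof.
by move=> e; apply/eqP; rewrite -[next a]/(iter 1 next a) iter_next_id e.
Qed.

(** Such a loop is its own only successor and its own only predecessor, so it annihilates every
    other arrow on both sides. *)
Lemma arrow_central a : valency B (tag a) = 1%N -> center (arrow a).
Proof.
move=> va; apply: central_of_gens => [i|b].
  by rewrite arrow_idem idem_arrow -[tgt a]/(src (next a)) next_val1 // eq_sym.
have [->//|nb] := eqVneq b a.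
rewrite [LHS]arrow_mul0 ?(next_val1 va) // [RHS]arrow_mul0 //.
apply: contra nb => /eqP eb.
by rewrite eb next_val1 // -[tag b]/(tag (next b)) -eb.
Qed.

Lemma val1_arrow_inj a b :
  valency B (tag a) = 1%N -> tag a = tag b -> a = b.
Proof.
case: a b => v p [w q] /= v1 e; subst w; congr Tagged.
by move: v1 p q; rewrite -size_succ_seq => -> p q; rewrite !ord1.
Qed.

Lemma prod_arrow_traject a l :
  \prod_(b <- a :: l) arrow b = 0 \/ a :: l = traject next a (size l).+1.
Proof.
elim: l a => [|b l IH] a; first by right.
have [->|nb] := eqVneq b (next a); last first.
  by left; rewrite !big_cons mulrA arrow_mul0 // mul0r.
case: (IH (next a)) => [p0|->]; last by right; rewrite /= size_traject.
by left; rewrite big_cons p0 mulr0.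
Qed.

(** Past a full period the trajectory restarts at [a], which relation (2) forbids. *)
Lemma prod_traject_period a n : (period B (tag a) < n)%N ->
  \prod_(b <- traject next a n) arrow b = 0.
Proof.
move=> /subnK <-; rewrite addnC addSnnS trajectD big_cat -cycle_powerE /=
  big_cons.
by rewrite iter_next_period mulrA cycle_arrow_self mul0r.
Qed.

Lemma exists_arrow_at i : exists a, src a == i.
Proof.
(* [arrow_other] asks for a vertex to avoid; any will do, and one exists because the multiplicities
   of [i] have a positive sum. *)
have [v _|noM] := pickP (fun _ : M => true); last first.
  by have := occ_sum_gt1 B i; rewrite big_pred0.
by have [a _ <-] := arrow_other occ1 i v; exists a.
Qed.

Lemma exists_arrow_tag v : exists a, tag a == v.
Proof.
have [i iv] := occ_cover B v.
have [|a <- _] := @arrow_at _ _ B occ1 v i; first by rewrite inE.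
by exists a.
Qed.

(** The choices are harmless: [cycle_power] depends only on the source of the arrow, and a vertex of
    valency one has a single arrow. *)
Definition out_arrow i : barrow B := xchoose (exists_arrow_at i).
Definition vertex_arrow v : barrow B := xchoose (exists_arrow_tag v).

Lemma src_out_arrow i : src (out_arrow i) = i.
Proof. exact/eqP/(xchooseP (exists_arrow_at i)). Qed.

Lemma tag_vertex_arrow v : tag (vertex_arrow v) = v.
Proof. exact/eqP/(xchooseP (exists_arrow_tag v)). Qed.

Definition val1_vertex := {v | valency B v == 1%N}.

Definition central_elt (j : 'I_m + val1_vertex) : L :=
  match j with
  | inl i => cycle_power (out_arrow i)
  | inr v => arrow (vertex_arrow (val v))
  end.

Lemma central_eltP j : center (central_elt j).
Proof.
case: j => [i|v]; first exact: cycle_power_central.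
by apply: arrow_central; rewrite tag_vertex_arrow; apply/eqP/(valP v).
Qed.

(** * Closed paths and the Peirce diagonal *)

Hypothesis mu1 : forall v, valency B v != 1%N -> mu B v = 1%N.

(** The length of a surviving nontrivial closed path is a multiple of the valency and at most the
    period. As [mu] is one above valency one, this leaves only the full period, or the loop when the
    valency is one. *)
Lemma closed_path (p : qpath Q) : pend p = pstart p ->
  [\/ pi (path_elt p) = 0, exists i, pi (path_elt p) = idem i
    | exists j, pi (path_elt p) = central_elt j].
Proof.
case ep: (parrows p) => [|a l] closed.
  by apply: Or32; exists (pstart p); congr (pi (path_elt _)); apply: qpath_inj.
have sp : src a = pstart p.
  by have := valP p : walk (pstart p) (parrows p); rewrite ep => /andP[/eqP].
rewrite (pi_pathE ep); case: (prod_arrow_traject a l) => [|el];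
  first exact: Or31.
(* The arrow following the path has the vertex and the source of [a], hence is [a], so the length is
   a multiple of the orbit size. *)
have : (valency B (tag a) %| (size l).+1)%N.
  rewrite -iter_next_id; apply/eqP/(arrow_inj occ1);
    first by rewrite tag_iter_next.
  rewrite sp -closed /pend ep el trajectSr map_rcons last_rcons.
  by [].
rewrite {}el; set n := (size l).+1 => dv.
have [lt_n|gt_n|en] := ltngtP n (period B (tag a)); last first.
- apply: Or33; exists (inl (pstart p)); rewrite en -cycle_powerE.
  by apply: cycle_power_src; rewrite src_out_arrow.
- by apply: Or31; rewrite prod_traject_period.
have [v1|nv] := eqVneq (valency B (tag a)) 1%N; last first.
  by move: lt_n; rewrite /period mu1 // muln1 ltnNge dvdn_leq.
have n1 : n = 1%N.
  by move: lt_n; rewrite /period v1 mul1n (mu_val1 v1) /n; case: size.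
have v1b : valency B (tag a) == 1%N by rewrite v1.
apply: Or33; exists (inr (Sub (tag a) v1b)); rewrite n1 big_seq1 /=;
  congr arrow.
by apply: val1_arrow_inj; rewrite ?tag_vertex_arrow.
Qed.

(** By linearity [u] may be taken to be a path; the sum keeps it if it is closed and kills it
    otherwise. *)
Lemma peirce_diagonal (u : L) :
  exists (e : 'I_m -> k) (c : 'I_m + val1_vertex -> k),
    \sum_i idem i * u * idem i =
    \sum_i e i *: idem i + \sum_j c j *: central_elt j.
Proof.
have [x ->] := quiver_pi_surj u; elim/pathalg_ind: x => [|x y|d p].
- exists (fun=> 0), (fun=> 0).
  rewrite ![X in _ = _ + X]big1 ?[X in _ = X + _]big1 ?addr0 ?big1 //.
  + by move=> i _; rewrite raddf0 mulr0 mul0r.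
  + by move=> i _; rewrite scale0r.
  + by move=> i _; rewrite scale0r.
- case=> e1 [c1 E1] [e2 [c2 E2]].
  exists (fun i => e1 i + e2 i), (fun j => c1 j + c2 j).
  under eq_bigr do rewrite raddfD mulrDr mulrDl.
  rewrite big_split /= E1 E2 addrACA -!big_split.
  by congr (_ + _); apply: eq_bigr => i _; rewrite scalerDl.
suff [e [c E]] : exists (e : 'I_m -> k) (c : 'I_m + val1_vertex -> k),
    \sum_i idem i * pi (path_elt p) * idem i =
    \sum_i e i *: idem i + \sum_j c j *: central_elt j.
  exists (fun i => d * e i), (fun j => d * c j).
  under eq_bigr do rewrite linearZ /= -quiver_alg_scaleAr -quiver_alg_scaleAl.
  rewrite -scaler_sumr E scalerDr !scaler_sumr.
  by congr (_ + _); apply: eq_bigr => i _; rewrite scalerA.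
have sum0 (J : finType) (F : J -> L) : \sum_j 0 *: F j = 0.
  by rewrite big1 // => j _; rewrite scale0r.
have sum1 (J : finType) (F : J -> L) j : \sum_j' (j' == j)%:R *: F j' = F j.
  rewrite (bigD1 j) //= eqxx scale1r big1 ?addr0 // => j' /negPf ->.
  by rewrite scale0r.
have -> : \sum_i idem i * pi (path_elt p) * idem i =
    if pend p == pstart p then pi (path_elt p) else 0.
  rewrite (bigD1 (pstart p)) //= idem_path eqxx path_idem big1 ?addr0 //.
  by move=> i /negPf ni; rewrite idem_path ni mul0r.
case: eqP => [/closed_path|_]; last first.
  by exists (fun=> 0), (fun=> 0); rewrite !sum0 addr0.
case=> [->|[i ->]|[j ->]].
- by exists (fun=> 0), (fun=> 0); rewrite !sum0 addr0.
- by exists (fun i' => (i' == i)%:R), (fun=> 0); rewrite sum0 sum1 addr0.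
- by exists (fun=> 0), (fun j' => (j' == j)%:R); rewrite sum0 sum1 add0r.
Qed.

(** * Linear forms vanishing on the ideal *)

(** No subpath of the socle cycle [C_v ^ mu v] has such a list of arrows. *)
Definition overlong (s : seq (barrow B)) :=
  forall v, all (fun b => tag b == v) s -> (period B v < size s)%N.

(** Relation (2) runs one arrow past the period; relation (3) mixes two vertices, so it is overlong
    vacuously. *)
Lemma brauer_rel_paths (x : pathalg k Q) : rel x ->
  (exists a b, src a = src b /\
     x = path_elt (cycle_path a) - path_elt (cycle_path b)) \/
  (exists2 p : qpath Q, x = path_elt p &
     (1 < size (parrows p))%N /\ overlong (parrows p)).
Proof.
case=> [a b e|a|a b nt e].
- by left; exists a, b; rewrite -!special_cycle_mu.
- right; exists (traject_path a (period B (tag a)).+1).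
    rewrite traject_pathE // trajectSr -cats1 big_cat big_seq1 special_cycleX.
    by rewrite -/(period B (tag a)) iter_next_period.
  rewrite /overlong size_traject ltnS period_gt0.
  by split=> // v /= /andP[/eqP <- _].
- right; have [p ep] := @pcomp_some _ (arrow_path a) (arrow_path b) e.
  exists p; first by rewrite [LHS]path_eltM /path_mul ep.
  case/pcompP: ep => _ _ -> /=; split=> // v /and3P[/eqP av /eqP bv _].
  by rewrite av bv eqxx in nt.
Qed.

Lemma eval_path3 (f : qpath Q -> k) (p q r : qpath Q) :
  (forall s : qpath Q,
     parrows s = parrows p ++ parrows q ++ parrows r -> f s = 0) ->
  pathalg_eval f (path_elt p * path_elt q * path_elt r) = 0.
Proof.
move=> f0; rewrite path_eltM /path_mul; case e: (pcomp p q) => [t|]; last first.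
  by rewrite mul0r raddf0.
apply: pathalg_eval_path_mul => s _ es; apply: f0.
by case/pcompP: e => _ _ e; rewrite es e catA.
Qed.

Lemma eval_short (f : qpath Q -> k) x :
  (forall p : qpath Q, (1 < size (parrows p))%N -> f p = 0) ->
  ideal_gen rel x -> pathalg_eval f x = 0.
Proof.
move=> f0; have f3 p q r : (1 < size (parrows q))%N ->
    pathalg_eval f (path_elt p * path_elt q * path_elt r) = 0.
  move=> lt_q; apply: eval_path3 => s es; apply: f0; rewrite es !size_cat.
  by rewrite addnCA; apply: leq_trans lt_q (leq_addr _ _).
have cycle_gt1 a : (1 < size (parrows (cycle_path a)))%N.
  by rewrite parrows_cycle_path size_traject period_gt1.
apply: pathalg_eval_ideal => {}x /brauer_rel_paths.
case=> [[a [b [_ ->]]]|[c -> [lt_c _]]] p q.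
  by rewrite mulrBr mulrBl raddfB /= !f3 ?subr0.
exact: f3.
Qed.

Definition path_coef (q p : qpath Q) : k := (p == q)%:R.

(** When every multiplicity is one, a path staying with one vertex must follow its special cycle, so
    the vertex, the length and the start identify [C_v ^ mu v] at [i]. *)
Definition is_cycle_path i (p : qpath Q) : bool :=
  (pstart p == i) && [exists v, all (fun b : barrow B => tag b == v) (parrows p)
                        && (size (parrows p) == period B v)].

(** Counting all vertices of [i] at once makes the form vanish on relation (1); the coefficient of a
    single cycle would not. *)
Definition socle_coef i (p : qpath Q) : k := (is_cycle_path i p)%:R.

Lemma is_cycle_pathE i a : is_cycle_path i (cycle_path a) = (src a == i).
Proof.
rewrite /is_cycle_path; case: existsP => [_|[]]; first by rewrite andbT.
exists (tag a); rewrite parrows_cycle_path size_traject eqxx andbT.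
by apply/allP => _ /trajectP[j _ ->]; rewrite tag_iter_next.
Qed.

Lemma socle_coef_short i (p : qpath Q) :
  (size (parrows p) <= 1)%N -> socle_coef i p = 0.
Proof.
rewrite /socle_coef /is_cycle_path => le1; case: existsP; rewrite ?andbF //.
by case=> v /andP[_ /eqP sz]; move: le1; rewrite sz leqNgt period_gt1.
Qed.

Lemma socle_coef_overlong i (p : qpath Q) :
  overlong (parrows p) -> socle_coef i p = 0.
Proof.
rewrite /socle_coef /is_cycle_path => lp; case: existsP; rewrite ?andbF //.
by case=> v /andP[/lp + /eqP sz]; rewrite sz ltnn.
Qed.

Lemma overlong_cat s1 s2 s3 : overlong s2 -> overlong (s1 ++ s2 ++ s3).
Proof.
move=> l2 v; rewrite !all_cat => /and3P[_ /l2 lt _]; apply: leq_trans lt _.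
by rewrite !size_cat addnCA leq_addr.
Qed.

Lemma overlong_cycle s1 a s3 : (0 < size s1 + size s3)%N ->
  overlong (s1 ++ parrows (cycle_path a) ++ s3).
Proof.
move=> gt0 v; rewrite !all_cat parrows_cycle_path => /and3P[_ tv _].
have -> : v = tag a.
  by move: tv; case: (period _ _) (period_gt0 B (tag a)) => //= n _ /andP[/eqP].
by rewrite !size_cat size_traject addnCA -[ltnLHS]addn0 ltn_add2l.
Qed.

(** Any nontrivial factor makes the path overlong. The value depends on [a] only through its source,
    so the two terms of relation (1) cancel. *)
Lemma socle_coef_cycle i a p q :
  pathalg_eval (socle_coef i)
    (path_elt p * path_elt (cycle_path a) * path_elt q)
  = [&& p == trivial_path (src a), q == trivial_path (src a) & src a == i]%:R.
Proof.
have trivP (r : qpath Q) : parrows r = [::] -> r = trivial_path (pstart r).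
  by move=> er; apply: qpath_inj.
case ep: (parrows p) => [|b l]; last first.
  rewrite eval_path3 => [|s es].
    by case: eqP => // tp; rewrite tp in ep.
  by apply: socle_coef_overlong; rewrite es ep; apply: overlong_cycle.
case eq: (parrows q) => [|b l]; last first.
  rewrite eval_path3 => [|s es].
    by case: (q =P _) => [tq|_]; rewrite ?andbF //; rewrite tq in eq.
  by apply: socle_coef_overlong; rewrite es eq; apply: overlong_cycle;
    rewrite addnC.
rewrite (trivP p ep) (trivP q eq) trivial_pathM.
have trivE j j' : (trivial_path j == trivial_path j' :> qpath Q) = (j == j').
  by apply/eqP/eqP => [/(congr1 (@pstart _))|->].
rewrite !trivE; case: eqP => [_|]; last by rewrite mul0r raddf0.
rewrite mul_trivial_path pend_cycle_path [src a == _]eq_sym.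
case: eqP => [_|_]; last by rewrite raddf0.
by rewrite pathalg_eval_path /socle_coef is_cycle_pathE.
Qed.

Lemma socle_coef_ideal i x :
  ideal_gen rel x -> pathalg_eval (socle_coef i) x = 0.
Proof.
apply: pathalg_eval_ideal => {}x /brauer_rel_paths.
case=> [[a [b [e ->]]]|[c -> [_ lc]]] p q.
  by rewrite mulrBr mulrBl raddfB /= !socle_coef_cycle e subrr.
apply: eval_path3 => s es; apply: socle_coef_overlong; rewrite es.
exact: overlong_cat.
Qed.

Lemma path_coef_ideal (q : qpath Q) x : (size (parrows q) <= 1)%N ->
  ideal_gen rel x -> pathalg_eval (path_coef q) x = 0.
Proof.
move=> le1; apply: eval_short => p lt1; rewrite /path_coef.
by case: eqP => // pq; move: le1; rewrite -pq leqNgt lt1.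
Qed.

Lemma arrow_neq0 a : arrow a <> 0.
Proof.
move=> /quiver_pi_eq0 /(@path_coef_ideal (arrow_path (a : qarrow Q)) _ isT)/eqP.
by rewrite pathalg_eval_path /path_coef eqxx oner_eq0.
Qed.

(** * Linear independence of the basis of the center *)

Definition center_basis (j : option ('I_m + val1_vertex)) : L :=
  if j is Some j then central_elt j else 1.

(** The lifts [rep] to [kQ] and the forms [dual] are biorthogonal, and the forms descend to the
    quotient. *)
Lemma center_basis_free (c : option ('I_m + val1_vertex) -> k) : (0 < m)%N ->
  \sum_j c j *: center_basis j = 0 -> forall j, c j = 0.
Proof.
(* The coefficient of [1] is read off at the trivial path of one fixed polygon. *)
move=> m_gt0 c0; pose i0 := Ordinal m_gt0.
pose rep (j : option ('I_m + val1_vertex)) : pathalg k Q := match j with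
  | None => 1
  | Some (inl i) => path_elt (cycle_path (out_arrow i))
  | Some (inr v) => arrow_elt k (vertex_arrow (val v) : qarrow Q) end.
have repE j : center_basis j = pi (rep j) by case: j => [[]|].
pose dual (j : option ('I_m + val1_vertex)) : qpath Q -> k := match j with
  | None => path_coef (trivial_path (i0 : qvertex Q))
  | Some (inl i) => socle_coef i
  | Some (inr v) =>
      path_coef (arrow_path (vertex_arrow (val v) : qarrow Q))
  end.
have dual0 j x : ideal_gen rel x -> pathalg_eval (dual j) x = 0.
  by case: j => [[i|v]|]; [exact: socle_coef_ideal|exact: path_coef_ideal..].
have sz2 a : (1 < size (parrows (cycle_path a)))%N.
  by rewrite parrows_cycle_path size_traject period_gt1.
have dualE j j' : pathalg_eval (dual j) (rep j') = (j' == j)%:R.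
  case: j' => [[i'|v']|] /=.
  - rewrite pathalg_eval_path; case: j => [[i|v]|] /=.
    + by rewrite /socle_coef is_cycle_pathE src_out_arrow.
    + rewrite /path_coef; case: eqP => // e; move: (sz2 (out_arrow i')).
      by rewrite e.
    + rewrite /path_coef; case: eqP => // e; move: (sz2 (out_arrow i')).
      by rewrite e.
  - rewrite pathalg_eval_path; case: j => [[i|v]|] /=.
    + by rewrite socle_coef_short.
    + rewrite /path_coef; congr (_%:R); congr nat_of_bool;
        apply/eqP/eqP => [|[->] //].
      move/(congr1 (@parrows _)) => [/(congr1 tag)].
      by rewrite !tag_vertex_arrow => /val_inj ->.
    + by rewrite /path_coef; case: eqP => // /(congr1 (@parrows _)).
  rewrite pathalg1E raddf_sum; under eq_bigr do rewrite /= pathalg_eval_path.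
  case: j => [[i|v]|] /=.
  - by rewrite big1 // => i' _; rewrite socle_coef_short.
  - by rewrite big1 // => i' _; rewrite /path_coef;
      case: eqP => // /(congr1 (@parrows _)).
  rewrite (bigD1 (i0 : qvertex Q)) //= /path_coef eqxx big1 ?addr0 // => i ni.
  by case: eqP => // /(congr1 (@pstart _)) ei; rewrite (ei : i = i0) eqxx in ni.
move=> j; have : pathalg_eval (dual j) (\sum_j' c j' *: rep j') = 0.
  apply: dual0; apply/quiver_pi_eq0; rewrite -[RHS]c0 raddf_sum.
  by apply: eq_bigr => j' _; rewrite repE -quiver_piZ.
rewrite raddf_sum (bigD1 j) //= linearZ /= dualE eqxx mulr1 big1 ?addr0 //.
by move=> j' nj; rewrite linearZ /= dualE (negPf nj) mulr0.
Qed.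

(** * Connectedness and the span of the center *)

Hypothesis conn : connected_config B.

(** Such a function is constant along each special cycle, hence on all polygons sharing a vertex. *)
Lemma connected_const (e : 'I_m -> k) :
  (forall a, e (src a) = e (tgt a)) -> forall i j, e i = e j.
Proof.
move=> ea; have const_cycle a j : e (src (iter j next a)) = e (src a).
  by elim: j => //= j <-; rewrite ea.
have eadj i j : adjacent B i j -> e i = e j.
  case/existsP=> v /andP[/(arrow_at occ1)[a av <-] /(arrow_at occ1)[b bv <-]].
  suff [n ->] : exists n, b = iter n next a by rewrite const_cycle.
  case: a b av bv => va p [vb q] /= ev; subst va => eb; subst vb.
  (* Rotation from position [p] to position [q], going through the end of the sequence so that no
     subtraction is truncated. *)
  exists (size (succ_seq B v) - p + q)%N; rewrite iter_next_Tagged;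
    congr Tagged.
  apply: val_inj; rewrite iter_ordS addnA subnKC ?modnDl ?modn_small ?ltn_ord
    //.
  exact: ltnW.
move=> i j; case/andP: conn => _ /forallP/(_ i)/forallP/(_ j)/connectP[s].
elim: s i => [|i' s IH] i /=; first by move=> _ ->.
by case/andP=> /eadj -> /IH; apply.
Qed.

Lemma center_basis_span (z : L) :
  center z <-> exists c : option ('I_m + val1_vertex) -> k,
    z = \sum_j c j *: center_basis j.
Proof.
have scaleC (d : k) (u : L) : center u -> center (d *: u).
  by move=> cu x; rewrite -quiver_alg_scaleAl cu quiver_alg_scaleAr.
have addC (u v : L) : center u -> center v -> center (u + v).
  by move=> cu cv x; rewrite mulrDl mulrDr cu cv.
have zeroC : center (0 : L) by move=> x; rewrite mul0r mulr0.
have sumC (c : 'I_m + val1_vertex -> k) : center (\sum_j c j *: central_elt j).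
  by elim/big_ind: _ => // j _; apply/scaleC/central_eltP.
split=> [cz|[c ->]]; last first.
  elim/big_ind: _ => // -[j|] _; apply: scaleC; first exact: central_eltP.
  by move=> x; rewrite mul1r mulr1.
have [e [c]] := peirce_diagonal z.
(* As [z] is central, its Peirce diagonal is [z] itself. *)
under eq_bigr do rewrite -cz -mulrA idemM eqxx.
rewrite -mulr_sumr sum_idem mulr1 => zE.
have ce : center (\sum_i e i *: idem i).
  have -> : \sum_i e i *: idem i = z + (-1) *: \sum_j c j *: central_elt j.
    by rewrite zE scaleN1r addrK.
  by apply: addC => //; apply: scaleC.
(* Commuting with [a] equates its multiples by the coefficients at its two ends, and [a] is
   nonzero. *)
have ea a : e (src a) = e (tgt a).
  have := ce (arrow a); rewrite mulr_suml mulr_sumr.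
  rewrite (bigD1 (src a)) //= -quiver_alg_scaleAl idem_arrow eqxx big1 ?addr0;
    last first.
    by move=> i /negPf ni; rewrite -quiver_alg_scaleAl idem_arrow ni scaler0.
  rewrite (bigD1 (tgt a)) //= -quiver_alg_scaleAr arrow_idem eqxx big1 ?addr0;
    last first.
    by move=> i /negPf ni;
      rewrite -quiver_alg_scaleAr arrow_idem eq_sym ni scaler0.
  move/eqP; rewrite -subr_eq0 -scalerBl.
  have [->//|ne] := eqVneq (e (src a)) (e (tgt a)).
  move/eqP/(congr1 (fun u => (e (src a) - e (tgt a))^-1 *: u)).
  by rewrite scalerA mulVf ?subr_eq0 // scale1r scaler0 => /arrow_neq0.
have m_gt0 : (0 < m)%N by case/andP: conn.
pose i0 : 'I_m := Ordinal m_gt0.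
(* The common coefficient of the idempotents becomes that of [1], which is their sum. *)
exists (fun j => if j is Some j then c j else e i0); rewrite zE.
rewrite (bigD1 None) //= -sum_idem scaler_sumr; congr (_ + _).
  by apply: eq_bigr => i _; rewrite (connected_const ea i i0).
rewrite (reindex_omap Some id) /=; last by case.
by apply: eq_bigl => j; rewrite eqxx.
Qed.

End BrauerAlgebra.

Theorem proposition1 (k : fieldType) (M : finType) (m : nat)
    (B : brauer_config M m) (n : nat)
    (occ1 : forall i u, u \in polygon B i -> occ B i u = 1%N)
    (val1 : #|[set v | valency B v == 1%N]| = n)
    (mu1 : forall v, valency B v != 1%N -> mu B v = 1%N)
    (conn : connected_config B) :
  has_dim (center (A := brauer_alg B k)) (m + n + 1).
Proof.
(* One basis vector [S_i] per polygon, one loop per vertex of valency one, and [1]. *)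
have -> : (m + n + 1 = #|{: option ('I_m + val1_vertex B)}|)%N.
  by rewrite card_option card_sum card_ord card_sig -val1 cardsE addn1.
apply: (@has_dim_finType _ _ _ _ (center_basis k occ1)) => [c|z].
  by apply: center_basis_free; case/andP: conn.
exact: center_basis_span.
Qed.
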